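(* Let $X$ be a polyhedral space and let $Y$ be a subspace of $X$ (with the norm inherited from $X$). Then every smooth linear functional on $Y$ admits a smooth Hahn-Banach extension to $X$ (that is, for every $f \in sm(B_{Y^*})$ there exists $\widetilde{f} \in sm(B_{X^*})$ with $\widetilde{f}|_Y = f$) if and only if $ext(B_Y) \subset ext(B_X)$.
   Context: All spaces are real and finite-dimensional. For a normed space $Z$, $B_Z$ and $S_Z$ denote the closed unit ball and the unit sphere, $Z^*$ is the dual space with the dual norm, and $ext(B_Z)$ is the set of extreme points of $B_Z$. A polyhedral space is a finite-dimensional real Banach space $X$ such that $B_X$ is a polyhedron; equivalently, $ext(B_X)$ is finite. A point $z \in S_Z$ is smooth if there is exactly one $\varphi \in S_{Z^*}$ with $\varphi(z) = 1$; $sm(B_Z)$ denotes the set of all smooth points lying in $S_Z$. A smooth linear functional on $Z$ is an element of $sm(B_{Z^*})$ (in particular it has norm $1$), i.e. a smooth point of the normed space $Z^*$. A Hahn-Banach extension is a norm-preserving linear extension.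
   Formalization: The subspace Y is assumed to be nonzero: for Y = {0} in a nonzero X the claim fails, since Y* has no smooth functionals (so the extension property is vacuous) while ext(B_Y) = {0} is not contained in ext(B_X). *)

(* Defs.v *)
From HB Require Import structures.
From mathcomp Require Import all_boot all_order all_algebra.
From mathcomp Require Import all_classical all_reals.
From mathcomp Require Import topology normedtype derive.

Set Implicit Arguments.
Unset Strict Implicit.
Unset Printing Implicit Defensive.

Import Order.TTheory GRing.Theory Num.Theory.
Import numFieldNormedType.Exports.

Local Open Scope classical_set_scope.
Local Open Scope ring_scope.

(* Finite-dimensional normed spaces; over a [realType] they are automatically
   complete. *)
#[short(type="normedVectType")]
HB.structure Definition NormedVector (R : numFieldType) :=
  {V of NormedModule R V & Vector R V}.

Section Subspace.
Context {R : realType} {X : normedVectType R} (Y : {vspace X}).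

Let subnorm (y : subvs_of Y) : R := `|vsval y|.

Let subnormD y z : subnorm (y + z) <= subnorm y + subnorm z.
Proof. by rewrite /subnorm linearD ler_normD. Qed.

Let subnormZ (a : R) y : subnorm (a *: y) = `|a| * subnorm y.
Proof. by rewrite /subnorm linearZ normrZ. Qed.

Let subnorm_eq0 y : subnorm y = 0 -> y = 0.
Proof. by move=> /normr0_eq0 y0; apply: val_inj; rewrite /= y0. Qed.

HB.instance Definition _ :=
  Lmodule_isNormed.Build R (subvs_of Y) subnormD subnormZ subnorm_eq0.

End Subspace.

Definition unit_ball {R : realType} (Z : normedVectType R) : set Z :=
  [set z | `|z| <= 1].
Arguments unit_ball {R} Z.

(* All linear maps Z -> R are continuous, as Z has finite dimension
   (see [dual_bounded] below). *)
Definition dual {R : realType} (Z : normedVectType R) := 'Hom(Z, R^o).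

HB.instance Definition _ {R : realType} (Z : normedVectType R) :=
  Vector.on (dual Z).

Definition dual_norm {R : realType} {Z : normedVectType R} (f : dual Z) : R :=
  sup [set `|f z| | z in unit_ball Z].

Section DualNorm.
Import VectorInternalTheory.
Context {R : realType}.

Let rV_linear_bounded n (W : normedModType R) (g : {linear 'rV[R]_n -> W}) :
  exists2 C : R, 0 <= C & forall v, `|g v| <= C * `|v|.
Proof.
exists (\sum_(i < n) `|g (delta_mx 0 i)|); first by rewrite sumr_ge0.
move=> v; rewrite {1}(row_sum_delta v) linear_sum /= mulr_suml.
apply: (le_trans (ler_norm_sum _ _ _)); apply: ler_sum => i _.
rewrite linearZ /= normrZ mulrC ler_wpM2l//.
rewrite [leRHS]/Num.norm /= mx_normrE.
by apply: (le_trans _ (le_bigmax _ _ (0, i))).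
Qed.

Variable Z : normedVectType R.

Let coord_le_norm :
  exists2 c : R, 0 < c & forall z : Z, c * `|v2r z| <= `|z|.
Proof.
pose S : set 'rV[R]_(dim Z) := [set v | `|v| = 1].
pose N (v : 'rV[R]_(dim Z)) : R := `|r2v v : Z|.
have cr : continuous (r2v : 'rV[R]_(dim Z) -> Z).
  have [C C0 HC] := @rV_linear_bounded (dim Z) Z r2v.
  apply/bounded_linear_continuous/bounded_funP => r.
  exists (C * r) => v vr; apply: (le_trans (HC v)).
  by rewrite ler_wpM2l.
have cN : continuous N.
  by move=> v; apply: continuous_comp; [exact: cr|exact: norm_continuous].
have [S0|S0] := pselect (S !=set0); last first.
  exists 1 => // z; have [->|z0] := eqVneq (v2r z) 0.
    by rewrite normr0 mulr0.
  exfalso; apply: S0; exists (`|v2r z|^-1 *: v2r z).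
  by rewrite /S /= normrZ normfV normr_id mulVf// normr_eq0.
have Sc : compact S.
  apply: bounded_closed_compact.
    exists 1; split=> [|x x1 v]; first exact: num_real.
    by rewrite /S /= => ->; exact: ltW.
  have -> : S = Num.norm @^-1` [set (1 : R)] by [].
  apply: closed_comp => [v _|]; first exact: norm_continuous.
  exact: closed_eq.
have [v0 + min0] := EVT_min_rV S0 Sc (continuous_subspaceT cN).
rewrite inE => v01.
exists (N v0).
  rewrite /N normr_gt0; apply/eqP => r0.
  move: v01; rewrite /S /= -(r2vK v0) r0 linear0 normr0.
  by move=> /esym/eqP; rewrite oner_eq0.
move=> z; have [->|z0] := eqVneq (v2r z) 0; first by rewrite normr0 mulr0.
have nz : 0 < `|v2r z| by rewrite normr_gt0.
have := min0 (`|v2r z|^-1 *: v2r z).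
rewrite inE /S /= normrZ normfV normr_id mulVf ?gt_eqF// => /(_ erefl).
rewrite {2}/N linearZ /= v2rK normrZ normfV normr_id.
by rewrite mulrC ler_pdivlMr.
Qed.

Lemma dual_bounded (f : dual Z) :
  exists2 C : R, 0 <= C & forall z, `|f z| <= C * `|z|.
Proof.
have [c c0 Hc] := coord_le_norm.
pose g v : R^o := f (r2v v).
have glin : linear g by move=> a u v; rewrite /g !linearP.
pose gL := GRing.isLinear.Build _ _ _ _ g glin.
pose G : {linear 'rV[R]_(dim Z) -> R^o} := HB.pack g gL.
have [C C0 HC] := rV_linear_bounded G.
exists (C / c) => [|z]; first by rewrite divr_ge0// ltW.
have := HC (v2r z); rewrite /G /= /g v2rK => /le_trans; apply.
by rewrite -mulrA ler_wpM2l// mulrC ler_pdivlMr// mulrC.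
Qed.

Let has_sup_dual (f : dual Z) : has_sup [set `|f z| | z in unit_ball Z].
Proof.
split; first by exists `|f 0|, 0 => //; rewrite /unit_ball /= normr0.
have [C C0 HC] := dual_bounded f; exists C => _ [z z1 <-].
by apply: (le_trans (HC z)); rewrite ler_piMr.
Qed.

Lemma dual_norm_ub (f : dual Z) z : `|z| <= 1 -> `|f z| <= dual_norm f.
Proof. by move=> z1; apply: (sup_upper_bound (has_sup_dual f)); exists z. Qed.

Lemma dual_norm_le (f : dual Z) C :
  (forall z, `|z| <= 1 -> `|f z| <= C) -> dual_norm f <= C.
Proof.
move=> HC; apply: ge_sup; first by case: (has_sup_dual f).
by move=> _ [z z1 <-]; exact: HC.
Qed.

Let dual_normD (f g : dual Z) : dual_norm (f + g) <= dual_norm f + dual_norm g.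
Proof.
apply: dual_norm_le => z z1; rewrite add_lfunE.
by apply: (le_trans (ler_normD _ _)); rewrite lerD ?dual_norm_ub.
Qed.

Let dual_norm_ge0 (f : dual Z) : 0 <= dual_norm f.
Proof. by apply: le_trans (@dual_norm_ub f 0 _); rewrite ?normr0. Qed.

Let dual_normZ_le (a : R) (f : dual Z) :
  dual_norm (a *: f) <= `|a| * dual_norm f.
Proof.
apply: dual_norm_le => z z1; rewrite scale_lfunE normrZ.
by rewrite ler_wpM2l// dual_norm_ub.
Qed.

Let dual_normZ (a : R) (f : dual Z) :
  dual_norm (a *: f) = `|a| * dual_norm f.
Proof.
apply/eqP; rewrite eq_le dual_normZ_le/=.
have [->|a0] := eqVneq a 0; first by rewrite normr0 mul0r.
have := dual_normZ_le a^-1 (a *: f).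
rewrite scalerA mulVf// scale1r normfV ler_pdivlMl ?normr_gt0//.
Qed.

Let dual_norm_eq0 (f : dual Z) : dual_norm f = 0 -> f = 0.
Proof.
move=> f0; apply/lfunP => z; rewrite zero_lfunE.
have [->|z0] := eqVneq z 0; first by rewrite linear0.
have nz : `|z| != 0 by rewrite normr_eq0.
have : `|f (`|z|^-1 *: z)| <= 0.
  by rewrite -f0; apply: dual_norm_ub; rewrite normrZ normfV normr_id mulVf.
rewrite linearZ normr_le0 scaler_eq0 invr_eq0 (negPf nz) /=.
by move/eqP.
Qed.

HB.instance Definition _ :=
  Lmodule_isNormed.Build R (dual Z) dual_normD dual_normZ dual_norm_eq0.

End DualNorm.

Definition extreme_points {R : realType} {V : lmodType R} (A : set V) : set V :=
  [set x | A x /\ forall (a b : V) (t : R), A a -> A b -> 0 < t < 1 ->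
     x = t *: a + (1 - t) *: b -> a = x /\ b = x].

Definition polyhedron {R : realType} {Z : normedVectType R} (A : set Z) : Prop :=
  exists (n : nat) (g : 'I_n -> dual Z) (c : 'I_n -> R),
    A = [set z | forall i, g i z <= c i].

Definition polyhedral_space {R : realType} (Z : normedVectType R) : Prop :=
  polyhedron (unit_ball Z).

Definition smooth_points {R : realType} (Z : normedVectType R) : set Z :=
  [set z | `|z| = 1 /\ exists! phi : dual Z, `|phi| = 1 /\ phi z = 1].
Arguments smooth_points {R} Z.

Definition hahn_banach_extension {R : realType} {X : normedVectType R}
    {Y : {vspace X}} (f : dual (subvs_of Y)) (F : dual X) : Prop :=
  (forall y : subvs_of Y, F (vsval y) = f y) /\ `|F| = `|f|.

(* Main.v *)
Require Import Defs.
From HB Require Import structures.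
From mathcomp Require Import all_boot all_order all_algebra.
From mathcomp Require Import all_classical all_reals.
From mathcomp Require Import topology normedtype.
From mathcomp Require Import ring lra.
Import Order.TTheory GRing.Theory Num.Theory.
Import numFieldNormedType.Exports.
Local Open Scope classical_set_scope.
Local Open Scope ring_scope.

(** In a finite-dimensional space the bidual consists of evaluations, so a
    functional [f] is smooth exactly when it exposes a point of the unit ball:
    [f] is bounded by 1 on the ball and takes the value 1 there at one point
    only ([smooth_dualP]).

    The unit ball of a polyhedral space is [{z | forall i, w i z <= 1}] for a
    finite family [w] of functionals, and restricting [w] to a subspace gives
    such a family there ([supports_subspace]).  Call [w i] active at [z] when
    [w i z = 1].  Two facts link exposed points, extreme points and active
    functionals.
    - If [z] is extreme, only 0 is annihilated by all functionals active at
      [z].  Hence every combination of the active functionals with positive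
      coefficients that takes the value 1 at [z] exposes [z]
      ([active_comb_exposes]); in particular their average does.
    - Conversely, a functional exposing [z] is a combination of the functionals
      active at [z] in which all coefficients are positive
      ([exposes_active_comb]); this follows from Farkas' lemma.

    Suppose that smooth functionals extend, and let [y] be extreme in the ball
    of [Y].  Some [f] exposes [y]; its smooth extension exposes a point of the
    ball of [X], which must be [y] because the extension takes the value 1 at
    [y].  So [y] is extreme in the ball of [X].

    Suppose that extreme points of the ball of [Y] are extreme in that of [X],
    and let [f] expose [y].  Write [f] as a positive combination of the
    restrictions to [Y] of the functionals active at [y].  The same combination
    of the unrestricted functionals extends [f], and it exposes [y] in [X]
    because [y] is extreme there. *)

Set Implicit Arguments.
Unset Strict Implicit.
Unset Printing Implicit Defensive.

(** * Farkas' lemma *)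

(** The proof is Bartl's induction on the number of functionals.  If dropping
    [u ord0] invalidates the implication, a witness [v0] of this has
    [u ord0 v0 > 0], and the induction hypothesis applies after projecting
    along [v0] onto the kernel of [u ord0]. *)
Lemma farkas (R : realFieldType) (V : vectType R) (n : nat)
    (u : 'I_n -> 'Hom(V, R^o)) (h : 'Hom(V, R^o)) :
  (forall v, (forall i, u i v <= 0 :> R) -> h v <= 0 :> R) ->
  exists2 a : 'I_n -> R, forall i, 0 <= a i & h = \sum_i a i *: u i.
Proof.
elim: n u h => [|n IH] u h hu.
  exists (fun=> 0) => //; rewrite big_ord0; apply/lfunP => v.
  rewrite zero_lfunE; apply/eqP; rewrite eq_le hu => [|[]//].
  by rewrite -oppr_le0 -linearN hu => [|[]].
have [hu'|] := pselect
    (forall v, (forall i, u (lift ord0 i) v <= 0 :> R) -> h v <= 0 :> R).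
  have [a a0 ->] := IH _ _ hu'.
  exists (fun i => if unlift ord0 i is Some j then a j else 0) => [i|].
    by case: unliftP.
  rewrite big_ord_recl unlift_none scale0r add0r.
  by apply: eq_bigr => i _; rewrite liftK.
move=> /existsNP[v0 /not_implyP[v0le /negP]]; rewrite -ltNge => hv0.
have u0 : 0 < u ord0 v0 :> R.
  rewrite ltNge; apply/negP => u0; move: hv0; rewrite ltNge => /negP; apply.
  by apply: hu => i; case: (unliftP ord0 i) => [j|] ->.
set c : R := u ord0 v0 in u0.
(* [p g] is [g] composed with the projection along [v0] onto the kernel of
   [u ord0]. *)
pose p (g : 'Hom(V, R^o)) : 'Hom(V, R^o) := g - ((g v0 : R) / c) *: u ord0.
have pD g : p g = g - ((g v0 : R) / c) *: u ord0 by [].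
have pE (g : 'Hom(V, R^o)) v :
    p g v = g (v - ((u ord0 v : R) / c) *: v0) :> R.
  have swap (x y z : R) : x - y / c * z = x - z / c * y by ring.
  rewrite /p add_lfunE opp_lfunE scale_lfunE [in RHS]linearB [in RHS]linearZ.
  exact: swap.
have [v vle|a a0 hE] := IH (fun i => p (u (lift ord0 i))) (p h).
  rewrite pE; apply: hu => i; case: (unliftP ord0 i) => [j|] ->.
    by rewrite -pE.
  rewrite linearB linearZ /= -/c /GRing.scale /= divfK ?gt_eqF//.
  by rewrite subrr.
pose b := (h v0 : R) / c - \sum_i a i * ((u (lift ord0 i) v0 : R) / c).
exists (fun i => if unlift ord0 i is Some j then a j else b) => [i|].
  case: unliftP => [j _|_]; first exact: a0.
  rewrite subr_ge0 (@le_trans _ _ 0)//; last by rewrite divr_ge0 ?ltW.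
  apply: sumr_le0 => j _; rewrite mulr_ge0_le0//.
  by rewrite ler_pdivrMr// mul0r.
rewrite big_ord_recl unlift_none.
under eq_bigr do rewrite liftK.
have -> : h = p h + ((h v0 : R) / c) *: u ord0 by rewrite pD subrK.
rewrite hE /b scalerBl [in RHS]addrAC -addrA addrC; congr (_ + _).
rewrite scaler_suml -sumrB; apply: eq_bigr => i _.
by rewrite pD scalerBr scalerA.
Qed.

(** * Exposed points and smooth functionals *)

Section Polyhedral.
Context {R : realType} {Z : normedVectType R}.
Implicit Types (f : dual Z) (z v : Z).

(** The unit ball is the intersection of the half-spaces [w i <= 1]. *)
Definition supports n (w : 'I_n -> dual Z) :=
  forall z, `|z| <= 1 <-> forall i, w i z <= 1 :> R.

(** On the unit ball, [f] has maximum 1, attained at [z] only. *)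
Definition exposes (f : dual Z) (z : Z) :=
  [/\ `|z| <= 1, f z = 1 :> R &
      forall x, `|x| <= 1 -> f x <= 1 :> R /\ (f x = 1 :> R -> x = z)].

(** Each inequality [g i <= c i] has [0 <= c i] since 0 lies in the ball, and is
    divided by [c i].  If [c i = 0] it is vacuous, because the ball is absorbing,
    and the convention [0^-1 = 0] replaces it by the equally vacuous [0 <= 1]. *)
Lemma polyhedral_supports : polyhedral_space Z ->
  exists n (w : 'I_n -> dual Z), supports w.
Proof.
move=> [n [g [c gc]]]; exists n, (fun i => (c i)^-1 *: g i) => z.
have ballE x : `|x| <= 1 <-> forall i, g i x <= c i :> R.
  have : unit_ball Z x <-> `|x| <= 1 by [].
  by rewrite gc => xE; exact: (iff_sym xE).
have c0 i : 0 <= c i.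
  have /ballE/(_ i) : `|0 : Z| <= 1 by rewrite normr0.
  by rewrite linear0.
rewrite ballE; split=> gz i; have := gz i; rewrite scale_lfunE /GRing.scale /=.
  have [->|ci] := eqVneq (c i) 0; first by rewrite invr0 mul0r ler01.
  by move=> ?; rewrite mulrC ler_pdivrMr ?mul1r// lt_def ci c0.
have [ci _|ci] := eqVneq (c i) 0; last first.
  by rewrite mulrC ler_pdivrMr ?mul1r// lt_def ci c0.
(* With [c i = 0], [g i] is nonpositive on the ball, hence at [z] by scaling. *)
have [->|z0] := eqVneq z 0; first by rewrite linear0.
have nz : 0 < `|z| by rewrite normr_gt0.
have /ballE/(_ i) : `| `|z|^-1 *: z| <= 1.
  by rewrite normrZ normfV normr_id mulVf// gt_eqF.
by rewrite ci linearZ /= /GRing.scale /= pmulr_rle0// invr_gt0.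
Qed.

Lemma exposes_norm f z : exposes f z -> `|f| = 1.
Proof.
move=> [z1 fz fle]; apply/eqP; rewrite eq_le; apply/andP; split.
  apply: dual_norm_le => x x1; rewrite ler_norml (fle x x1).1 andbT.
  by have := (fle (- x)); rewrite normrN linearN lerNl => /(_ x1)[].
by rewrite -[leLHS]normr1 -fz; exact: dual_norm_ub.
Qed.

Lemma exposes_extreme f z : exposes f z -> extreme_points (unit_ball Z) z.
Proof.
move=> [z1 fz fle]; split=> // a b t /fle[fa ea] /fle[fb eb] /andP[t0 t1] zE.
have : f z = t * (f a : R) + (1 - t) * (f b : R) :> R.
  by rewrite zE linearD !linearZ.
rewrite fz => E.
suff [fa1 fb1] : (f a = 1 :> R) /\ (f b = 1 :> R)
  by split; [exact: ea|exact: eb].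
move: fa fb E; move: (f a : R) (f b : R) => x y x1 y1 E.
have s0 : 0 < 1 - t by rewrite subr_gt0.
have : t * (1 - x) + (1 - t) * (1 - y) == 0.
  by rewrite !mulrBr !mulr1 addrACA -opprD -E subrKC subrr.
rewrite paddr_eq0; last 2 first.
- by apply: mulr_ge0; [exact: ltW|rewrite subr_ge0].
- by apply: mulr_ge0; [exact: ltW|rewrite subr_ge0].
rewrite !mulf_eq0 (gt_eqF t0) (gt_eqF s0) !subr_eq0 /=.
by move=> /andP[/eqP <- /eqP <-].
Qed.

(** Evaluation at [z], as a function on the dual. *)
Definition eval_at z (f : dual Z) : R^o := f z.

Lemma eval_at_is_linear z : linear (eval_at z).
Proof. by move=> a f g; rewrite /eval_at add_lfunE scale_lfunE. Qed.

HB.instance Definition _ z :=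
  GRing.isLinear.Build R (dual Z) R^o *:%R (eval_at z) (eval_at_is_linear z).

(** The canonical image of [z] in the bidual. *)
Definition evaluation z : dual (dual Z) := linfun (eval_at z).

(** Finite-dimensional spaces are reflexive; the point representing [phi] has
    as coordinates in a basis the values of [phi] at the dual basis. *)
Lemma bidual_eval (phi : dual (dual Z)) :
  exists z, forall f, phi f = f z :> R.
Proof.
pose e := vbasis {:Z}.
pose co i : dual Z := linfun (coord e i).
exists (\sum_i (phi (co i) : R) *: e`_i) => f.
have {1}-> : f = \sum_(i < \dim {:Z}) (f e`_i : R) *: co i.
  apply/lfunP => x; rewrite {1}(coord_vbasis (memvf x)) linear_sum.
  rewrite sum_lfunE; apply: eq_bigr => i _.
  by rewrite linearZ scale_lfunE lfunE /= /GRing.scale /= mulrC.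
rewrite !linear_sum; apply: eq_bigr => i _.
by rewrite !linearZ /= /GRing.scale /= mulrC.
Qed.

Lemma dual_le_norm f z : f z <= `|f| * `|z| :> R.
Proof.
have [->|z0] := eqVneq z 0; first by rewrite linear0 normr0 mulr0.
have nz : 0 < `|z| by rewrite normr_gt0.
rewrite -ler_pdivrMr// mulrC.
have -> : `|z|^-1 * (f z : R) = f (`|z|^-1 *: z) by rewrite linearZ.
apply: (le_trans (ler_norm _)); apply: dual_norm_ub.
by rewrite normrZ normfV normr_id mulVf// gt_eqF.
Qed.

Section Supports.
Variables (n : nat) (w : 'I_n -> dual Z).
Hypothesis wP : supports w.

(** From a point of the ball one can move a little in any direction along which
    no active functional increases. *)
Lemma supports_step z v : `|z| <= 1 ->
    (forall i, w i z = 1 :> R -> w i v <= 0 :> R) ->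
  exists2 e : R, 0 < e & `|z + e *: v| <= 1.
Proof.
move=> /wP wz wv.
pose q i : R := `|w i v : R| / (1 - (w i z : R)).
have q0 i : 0 <= q i by rewrite divr_ge0// subr_ge0.
have s0 : 0 < 1 + \sum_i q i by rewrite ltr_wpDr// sumr_ge0.
exists (1 + \sum_i q i)^-1; first by rewrite invr_gt0.
apply/wP => i; rewrite linearD linearZ /= /GRing.scale /=.
have [wz1|wz1] := eqVneq (w i z : R) 1.
  by rewrite wz1 gerDl pmulr_rle0 ?invr_gt0// wv.
have d0 : 0 < 1 - (w i z : R) by rewrite subr_gt0 lt_neqAle wz1 wz.
rewrite -lerBrDl ler_pdivrMl//; apply: (le_trans (ler_norm _)).
rewrite -ler_pdivrMr// (bigD1 i)//= -/(q i) addrCA lerDl addr_ge0//.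
exact: sumr_ge0.
Qed.

(** Otherwise one could move from [z] along both [v] and [- v]. *)
Lemma extreme_active_inj z v : extreme_points (unit_ball Z) z ->
  (forall i, w i z = 1 :> R -> w i v = 0 :> R) -> v = 0.
Proof.
move=> [z1 zext] wv.
have [i wi|e e0 ze] := @supports_step z v z1; first by rewrite wv.
have [i wi|d d0 zd] := @supports_step z (- v) z1.
  by rewrite linearN /= wv ?oppr0.
have ed : 0 < e + d by rewrite addr_gt0.
(* The weights are those of [z] as a barycentre of [z + e *: v] and
   [z - d *: v]. *)
have [||zE _] := zext _ _ (d / (e + d)) ze zd.
- by rewrite divr_gt0//= ltr_pdivrMr// mul1r ltrDr.
- rewrite scalerN !scalerDr scalerN !scalerA addrACA -scalerDl subrKC scale1r.
  rewrite -scalerBl [X in X *: v](_ : _ = 0) ?scale0r ?addr0//.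
  by field; rewrite gt_eqF.
apply/eqP; have /eqP := zE.
by rewrite -subr_eq0 addrC addKr scaler_eq0 gt_eqF.
Qed.

(** The family [w] is norming: if no [w i] reached 1 at the normalised point,
    one could move outwards from it. *)
Lemma supports_attain z : z != 0 -> exists i, w i z = `|z| :> R.
Proof.
move=> z0; have nz : 0 < `|z| by rewrite normr_gt0.
pose x := `|z|^-1 *: z.
have x1 : `|x| = 1 by rewrite normrZ normfV normr_id mulVf// gt_eqF.
have [[i wx]|noact] := pselect (exists i, w i x = 1 :> R).
  exists i; have -> : z = `|z| *: x by rewrite scalerA divff ?gt_eqF// scale1r.
  by rewrite linearZ /= wx /GRing.scale /= mulr1 normrZ x1 normr_id mulr1.
have [|i wi|e e0] := @supports_step x x; rewrite ?x1//.
  by case: noact; exists i.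
rewrite -{1}[x]scale1r -scalerDl normrZ x1 mulr1 ger0_norm; last by lra.
by move=> ?; exfalso; lra.
Qed.

Lemma supports_norm i : `|w i| <= 1.
Proof.
apply: dual_norm_le => z z1; rewrite ler_norml ((wP z).1 z1) andbT.
by rewrite lerNl -linearN; apply/(wP (- z)).1; rewrite normrN.
Qed.

(** The canonical embedding into the bidual is isometric. *)
Lemma bidual_norm (phi : dual (dual Z)) z :
  (forall f, phi f = f z :> R) -> `|phi| = `|z|.
Proof.
move=> phiE; apply/eqP; rewrite eq_le; apply/andP; split.
  apply: dual_norm_le => f f1; rewrite phiE ler_norml lerNl.
  have -> : - (f z : R) = f (- z) by rewrite linearN.
  by rewrite !(le_trans (dual_le_norm _ _))// ?normrN ler_piMl.
have [->|z0] := eqVneq z 0; first by rewrite normr0.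
have [i <-] := supports_attain z0.
rewrite -phiE; apply: (le_trans (ler_norm _)).
exact/dual_norm_ub/supports_norm.
Qed.

Lemma supports_separates z : (forall i, w i z = 0 :> R) -> z = 0.
Proof.
move=> wz; apply/eqP; apply: contraT => z0; have [i] := supports_attain z0.
by rewrite wz => /esym/eqP; rewrite normr_eq0 (negPf z0).
Qed.

Lemma smooth_dualP f :
  smooth_points (dual Z) f <-> exists z, exposes f z.
Proof.
split=> [[f1 [phi [[phi1 phif] phiU]]]|[z fz]].
  have [z phiE] := bidual_eval phi.
  have z1 : `|z| = 1 by rewrite -(bidual_norm phiE).
  exists z; split=> [||x x1]; rewrite ?z1 -?phiE//.
  split=> [|fx].
    by apply: (le_trans (dual_le_norm _ _)); rewrite f1 mul1r.
  have nx : `|x| = 1.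
    apply/eqP; rewrite eq_le x1 /=.
    by have := dual_le_norm f x; rewrite fx f1 mul1r.
  have psiE g : evaluation x g = g x :> R by rewrite lfunE.
  have phix : phi = evaluation x.
    by apply: phiU; rewrite (bidual_norm psiE) psiE.
  apply/eqP; rewrite -subr_eq0; apply/eqP/supports_separates => i.
  by rewrite linearB /= -phiE phix psiE subrr.
have f1 := exposes_norm fz; have [z1 fz1 fle] := fz.
have nz : `|z| = 1.
  apply/eqP; rewrite eq_le z1 /=.
  by have := dual_le_norm f z; rewrite fz1 f1 mul1r.
have zE g : evaluation z g = g z :> R by rewrite lfunE.
split=> //; exists (evaluation z); split.
  by rewrite (bidual_norm zE) zE.
move=> psi [psi1 psif]; have [x xE] := bidual_eval psi.
have xz : x = z.
  apply: (fle x _).2; first by rewrite -(bidual_norm xE) psi1.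
  by rewrite -xE.
by apply/lfunP => g; rewrite zE xE xz.
Qed.

(** * Functionals active at an extreme point *)

(** At a point [x] of the ball where the combination equals 1, every active
    functional equals 1 as well, so [x - z] is annihilated by all of them. *)
Lemma active_comb_exposes (a : 'I_n -> R) z :
    extreme_points (unit_ball Z) z -> (forall i, 0 < a i) ->
    (\sum_(i | (w i z : R) == 1) a i *: w i) z = 1 :> R ->
  exposes (\sum_(i | (w i z : R) == 1) a i *: w i) z.
Proof.
move=> zext a0 fz1; split=> // [|x x1]; first by case: zext.
have sE y : (\sum_(i | (w i z : R) == 1) a i *: w i) y
    = \sum_(i | (w i z : R) == 1) a i * (w i y : R) :> R.
  by rewrite sum_lfunE; apply: eq_bigr => i _; rewrite scale_lfunE.
have gap0 i : (w i z : R) == 1 -> 0 <= a i * (1 - (w i x : R)).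
  by move=> _; rewrite mulr_ge0 ?(ltW (a0 i))// subr_ge0 (wP x).1.
have gapE : 1 - \sum_(i | (w i z : R) == 1) a i * (w i x : R)
    = \sum_(i | (w i z : R) == 1) a i * (1 - (w i x : R)).
  rewrite -{1}fz1 sE -sumrB; apply: eq_bigr => i /eqP ->.
  by rewrite mulrBr.
rewrite sE; split=> [|fx]; first by rewrite -subr_ge0 gapE sumr_ge0.
apply/eqP; rewrite -subr_eq0; apply/eqP.
apply: (@extreme_active_inj z) => // i wi.
move: gapE; rewrite fx subrr => /esym/eqP; rewrite psumr_eq0// => /allP.
move=> /(_ i (mem_index_enum i)); rewrite wi eqxx /= mulf_eq0 gt_eqF//=.
by rewrite subr_eq0 => /eqP wx; rewrite linearB /= wi -wx subrr.
Qed.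

(** In geometric terms, [f] lies in the relative interior of the cone generated
    by the functionals active at [z]. *)
Lemma exposes_active_comb f z : exposes f z ->
  exists2 a : 'I_n -> R, forall i, 0 < a i &
    f = \sum_(i | (w i z : R) == 1) a i *: w i.
Proof.
move=> [z1 fz fle].
(* [f] is negative at every nonzero direction pointing into the ball from
   [z]. *)
have cone v : (forall i, w i z = 1 :> R -> w i v <= 0 :> R) ->
    0 <= f v :> R -> v = 0.
  move=> wv fv; have [e e0 ze] := supports_step z1 wv.
  have [fe feq] := fle _ ze.
  have fE : f (z + e *: v) = 1 + e * (f v : R) :> R.
    by rewrite linearD linearZ /= fz.
  have /feq zE : f (z + e *: v) = 1 :> R.
    by apply/eqP; rewrite eq_le fe fE lerDl mulr_ge0// ltW.
  have /eqP : e *: v = 0 by rewrite -[LHS](addKr z) zE addNr.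
  by rewrite scaler_eq0 gt_eqF//= => /eqP.
have [i wiz] : exists i, w i z = 1 :> R.
  apply: contrapT => noact; have z0 : z = 0.
    by apply: cone => [i wi|]; [case: noact; exists i|rewrite fz].
  by move: fz; rewrite z0 linear0 => /esym/eqP; rewrite oner_eq0.
(* Farkas' lemma, applied to the active functionals and [- f], represents minus
   the sum of the active functionals.  Moving [f] to the left and that sum to
   the right gives a multiple of [f] with all coefficients at least 1.
   Inactive functionals are replaced by 0. *)
pose A i := (w i z : R) == 1.
pose u (k : 'I_n.+1) : dual Z :=
  if unlift ord0 k is Some j then if A j then w j else 0 else - f.
have uS j : u (lift ord0 j) = if A j then w j else 0 by rewrite /u liftK.
have u0 : u ord0 = - f by rewrite /u unlift_none.
have [v uv|b b0] := @farkas _ _ _ u (- \sum_(i | A i) w i).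
  rewrite [v]cone ?linear0// => [j /eqP wj|].
    by have := uv (lift ord0 j); rewrite uS /A wj.
  by have := uv ord0; rewrite u0 opp_lfunE oppr_le0.
rewrite big_ord_recl u0 scalerN => hE.
pose c i := 1 + b (lift ord0 i).
have c0 j : 0 < c j by rewrite ltr_pwDl.
have bf : b ord0 *: f = \sum_(i | A i) c i *: w i.
  transitivity (\sum_(i | A i) w i
      + \sum_i b (lift ord0 i) *: u (lift ord0 i)).
    by rewrite -[X in _ = X + _]opprK hE opprD opprK subrK.
  rewrite [X in _ + X](bigID A) /= [X in _ + (_ + X)]big1 ?addr0.
    rewrite -big_split; apply: eq_bigr => j Aj.
    by rewrite uS Aj /c scalerDl scale1r.
  by move=> j /negPf Aj; rewrite uS Aj scaler0.
have bpos : 0 < b ord0.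
  have : (b ord0 *: f) z = \sum_(i | A i) c i :> R.
    rewrite bf sum_lfunE; apply: eq_bigr => j /eqP wj.
    by rewrite scale_lfunE wj /GRing.scale /= mulr1.
  rewrite scale_lfunE fz /GRing.scale /= mulr1 => ->.
  rewrite (bigD1 i) /=; last exact/eqP.
  by rewrite ltr_pwDl// sumr_ge0// => j _; rewrite ltW.
exists (fun i => (b ord0)^-1 * c i) => [j|].
  by rewrite mulr_gt0// invr_gt0.
under eq_bigr do rewrite -scalerA.
by rewrite -scaler_sumr -bf scalerA mulVf ?gt_eqF// scale1r.
Qed.

(** The exposing functional is the average of those active at [z].  The space
    must be nonzero for some functional to be active: in the zero space, 0 is
    an extreme point. *)
Lemma extreme_exposed z : (exists x : Z, x != 0) ->
  extreme_points (unit_ball Z) z -> exists f, exposes f z.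
Proof.
move=> [x x0] zext.
have [i wi] : exists i, w i z = 1 :> R.
  apply: contrapT => noact; move/eqP: x0; apply.
  by apply: (@extreme_active_inj z) => // i wi; case: noact; exists i.
pose N : R := \sum_(i | (w i z : R) == 1) 1.
have N0 : 0 < N.
  rewrite /N (bigD1 i) /=; last exact/eqP.
  by rewrite ltr_pwDl// sumr_ge0.
exists (\sum_(i | (w i z : R) == 1) N^-1 *: w i).
apply: (@active_comb_exposes (fun=> N^-1)) => // [_|].
  by rewrite invr_gt0.
transitivity (\sum_(j | (w j z : R) == 1) N^-1 * 1).
  rewrite sum_lfunE; apply: eq_bigr => j /eqP wj.
  by rewrite scale_lfunE wj.
by rewrite -mulr_sumr mulVf ?gt_eqF.
Qed.

End Supports.
End Polyhedral.

(** * Subspaces and extensions *)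

Lemma supports_subspace (R : realType) (X : normedVectType R) (Y : {vspace X})
    n (w : 'I_n -> dual X) : supports w ->
  supports (fun i => (w i \o linfun vsval)%VF : dual (subvs_of Y)).
Proof.
move=> wP y; rewrite -[`|y|]/(`|vsval y|) wP.
by split=> wy i; have := wy i; rewrite comp_lfunE lfunE.
Qed.

Theorem corollary1p3 (R : realType) (X : normedVectType R) (Y : {vspace X})
    (hX : polyhedral_space X) (hY : Y != 0%VS) :
  (forall f : dual (subvs_of Y), smooth_points (dual (subvs_of Y)) f ->
     exists F : dual X,
       smooth_points (dual X) F /\ hahn_banach_extension f F) <->
  vsval @` extreme_points (unit_ball (subvs_of Y)) `<=`
    extreme_points (unit_ball X).
Proof.
have [n [w wP]] := polyhedral_supports hX.
have wYP := @supports_subspace _ _ Y _ _ wP.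
have Yn0 : exists y : subvs_of Y, y != 0.
  exists (vsproj Y (vpick Y)); apply: contra_neq hY => p0.
  by apply/eqP; rewrite -vpick0 -(vsprojK (memv_pick Y)) p0 linear0.
split=> [ext_smooth _ [y yext <-]|ext_sub f /(smooth_dualP wYP)[y fy]].
  have [f fy] := extreme_exposed wYP Yn0 yext.
  have /ext_smooth[F [/(smooth_dualP wP)[z Fz] [Ff _]]] :
      smooth_points (dual (subvs_of Y)) f.
    by apply/(smooth_dualP wYP); exists y.
  have [y1 fy1 _] := fy; have [_ _ Fle] := Fz.
  have -> : vsval y = z by apply: (Fle (vsval y) y1).2; rewrite Ff.
  exact: exposes_extreme Fz.
have yext : extreme_points (unit_ball X) (vsval y).
  by apply: ext_sub; exists y => //; exact: exposes_extreme fy.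
have [a a0 fE] := exposes_active_comb wYP fy.
pose F : dual X := \sum_(i | (w i (vsval y) : R) == 1) a i *: w i.
have Ff v : F (vsval v) = f v.
  rewrite fE /F !sum_lfunE; apply: eq_big => [i|i _].
    by rewrite comp_lfunE lfunE.
  by rewrite !scale_lfunE comp_lfunE lfunE.
have Fy : exposes F (vsval y).
  by apply: active_comb_exposes => //; rewrite Ff; case: fy.
exists F; split; first by apply/(smooth_dualP wP); exists (vsval y).
by split=> //; rewrite (exposes_norm Fy) (exposes_norm fy).
Qed.
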